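(* Let $S$ be a numerical semigroup with multiplicity $4$ and Apéry set $\{0,a_1,a_2,a_3\}$, $a_i \equiv i \bmod 4$, and suppose $a_3 = a_1 + a_2$. Let $\Bbbk$ be a field. Then the sequence $\mathcal F'_\bullet : 0 \longleftarrow F'_0 \longleftarrow F'_1 \longleftarrow F'_2 \longleftarrow \cdots$ with maps $\partial : F'_d \to F'_{d-1}$ (both defined in the context) is a graded free resolution of $\Bbbk$ over $\Bbbk[S]$ that is minimal if and only if $b_{11} > 0$.
   Context: A numerical semigroup is a cofinite additively closed set $S \subseteq \mathbb Z_{\ge 0}$ containing $0$; its multiplicity is $m=\min(S\setminus\{0\})$, here $m = 4$. Its Apéry set is $\operatorname{Ap}(S) = \{n \in S : n - 4 \notin S\} = \{0, a_1, a_2, a_3\}$ with $a_i \equiv i \bmod 4$. Set $a_0 = 4$. Indices are read modulo $4$, and $b_{ij} = \frac14(a_i + a_j - a_{i+j}) \in \mathbb Z_{\ge 0}$; in particular $b_{11} = \frac14(2a_1 - a_2)$ and $b_{22} = \frac14(2a_2 - 4)$. Let $R = \Bbbk[y,x_1,x_2,x_3]/I_S \cong \Bbbk[S]$, where $\deg y = 4$, $\deg x_i = a_i$, $x_0 = y$, and $I_S$ is the kernel of $y \mapsto t^4$, $x_i \mapsto t^{a_i}$ into $\Bbbk[t]$. The field $\Bbbk$ is the quotient of $R$ by the ideal generated by $y,x_1,x_2,x_3$. (Since $a_3=a_1+a_2$, $x_3 = x_1x_2$ in $R$ and $S = \langle 4,a_1,a_2\rangle$.) Let $\mathcal A$ be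 the collection of all finite multisets of elements from $\{0,1,2\}$. For $\mathbf c \in \mathcal A$ let $c_i$ be the number of copies of $i$ in $\mathbf c$ and $|\mathbf c| = c_0+c_1+c_2$. Write $\mathbf c + i$ for the multiset with one additional copy of $i$, and, if $c_i>0$, $\mathbf c - i$ for the multiset with one less copy of $i$; repeated symbols denote repeated operations, e.g. $\mathbf c - 11 + 2$ removes two copies of $1$ and adds one copy of $2$. The module $F'_d$ is the free graded $R$-module generated by the symbols $e'_{\mathbf c}$ with $\mathbf c\in\mathcal A$, $|\mathbf c| = d$, $\deg(e'_{\mathbf c}) = \sum_{i=0}^2 c_i\deg(x_i)$, with the convention $e'_{\mathbf c} = 0$ if $c_0 > 1$ (the $e'_{\mathbf c}$ with $c_0\le 1$ form a basis, so $\operatorname{rank}F'_d = 2d+1$). Any symbol requiring removal of more copies of an element than are present is also $0$. The $R$-linear map $\partial : F'_d \to F'_{d-1}$, $d\ge 1$, is $$e'_{\mathbf c} \mapsto \begin{cases} x_2 e'_{\mathbf c-2} + x_1 e'_{\mathbf c-1} - y^{b_{11}} e'_{\mathbf c-11+2} + (-1)^{d-1}\bigl(y e'_{\mathbf c-0} + y^{b_{22}} e'_{\mathbf c-22+0}\bigr) & \text{if } 2\mid c_2,\\ x_2 e'_{\mathbf c-2} - x_1 e'_{\mathbf c-1} + (-1)^{d-1}\bigl(y e'_{\mathbf c-0} + y^{b_{22}} e'_{\mathbf c-22+0}\bigr) & \text{if } 2\nmid c_2.\end{cases}$$ A graded free resolution is minimal if the matrices of its maps contain no nonzero constant entries. 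*)

(* Defs.v *)
From HB Require Import structures.
From mathcomp Require Import all_boot all_order all_algebra.
From mathcomp Require Import finmap multiset.

Set Implicit Arguments.
Unset Strict Implicit.
Unset Printing Implicit Defensive.

Import GRing.Theory.
Local Open Scope fset_scope.
Local Open Scope mset_scope.
Local Open Scope ring_scope.

(** * Numerical semigroups *)

Record numSemigroup := NumSemigroup {
  ns_pred :> pred nat;
  ns0 : ns_pred 0%N;
  nsD : forall m n, ns_pred m -> ns_pred n -> ns_pred (m + n)%N;
  ns_cofinite : exists N, forall n, (N <= n)%N -> ns_pred n }.

Definition is_multiplicity (S : numSemigroup) (m : nat) : Prop :=
  [/\ (0 < m)%N, S m & forall n, S n -> (0 < n)%N -> (m <= n)%N].

(* [n - m] is the integer difference, which is not in S when n < m. *)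
Definition apery (S : numSemigroup) (m : nat) : pred nat :=
  fun n => S n && ~~ ((m <= n)%N && S (n - m)%N).

(* i |-> a_i, with a_0 = 4 and indices read modulo 4. *)
Definition apery_coord (a1 a2 a3 : nat) (i : nat) : nat :=
  nth 0%N [:: 4; a1; a2; a3] (i %% 4).

(* Subtraction and division are exact whenever [a] lists the Apery set of a
   semigroup of multiplicity 4: see [apery_bE]. *)
Definition apery_b (a : nat -> nat) (i j : nat) : nat :=
  ((a i + a j - a (i + j)%N) %/ 4)%N.

(* The residue field k; the parameter S carries its k[S]-module structure. *)
Definition resfield (k : fieldType) (S : numSemigroup) : Type := k.

(** * The semigroup algebra k[S], as the subring of k[t] spanned by the t^s *)

Section SemigroupAlgebra.
Variables (k : fieldType) (S : numSemigroup).

Definition supp_in : {pred {poly k}} :=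
  fun p => all (fun i => (p`_i != 0) ==> S i) (iota 0 (size p)).

Lemma supp_inP (p : {poly k}) :
  reflect (forall i, p`_i != 0 -> S i) (p \in supp_in).
Proof.
apply: (iffP allP) => [h i pi0 | h i _]; last exact/implyP/h.
have ip : (i < size p)%N by rewrite ltnNge; apply: contra pi0 => /leq_sizeP->.
by apply: (implyP (h i _)); rewrite ?mem_iota.
Qed.

Fact supp_in_subring : subring_closed supp_in.
Proof.
split=> [|p q /supp_inP hp /supp_inP hq|p q /supp_inP hp /supp_inP hq];
  apply/supp_inP=> i.
- by rewrite coef1; case: i => [|i]; rewrite ?ns0 ?eqxx.
- rewrite coefB; have [->|/hp //] := eqVneq p`_i 0.
  by rewrite sub0r oppr_eq0; apply: hq.
- rewrite coefM; apply: contraR => nSi; apply/eqP; apply: big1 => j _.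
  have [->|/hp Sj] := eqVneq p`_j 0; first by rewrite mul0r.
  have [->|/hq Sij] := eqVneq q`_(i - j) 0; first by rewrite mulr0.
  by case/negP: nSi; rewrite -(subnKC (leq_ord j)); apply: nsD.
Qed.

HB.instance Definition _ :=
  GRing.isSubringClosed.Build {poly k} supp_in supp_in_subring.

Record sgalg := SgAlg { sgval :> {poly k}; sgvalP : sgval \in supp_in }.

HB.instance Definition _ := [isSub for sgval].
HB.instance Definition _ := [Choice of sgalg by <:].
HB.instance Definition _ := [SubChoice_isSubComNzRing of sgalg by <:].

(* t^n, meaningful for n in S only (0 otherwise): see [sg_mon_val]. *)
Definition sg_mon (n : nat) : sgalg := insubd 0 'X^n.

Lemma sg_mon_val n : S n -> sgval (sg_mon n) = 'X^n.
Proof.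
move=> Sn; rewrite /sg_mon -[sgval _]/(val _) val_insubd ifT //.
by apply/supp_inP=> i; rewrite coefXn; case: (eqVneq i n) => [-> // | _]; rewrite eqxx.
Qed.

(** * The residue field as a k[S]-module

  A polynomial acts on k through its constant coefficient; [residue_kernel]
  shows that this is the quotient of k[S] by the ideal (y, x_1, x_2, x_3). *)

Definition residue (r : sgalg) : k := (sgval r)`_0.

Local Notation resfield := (resfield k S).
HB.instance Definition _ := GRing.Zmodule.on resfield.

Definition res_scale (r : sgalg) (v : resfield) : resfield :=
  (residue r * (v : k) : k).

Fact res_scaleA r s v : res_scale r (res_scale s v) = res_scale (r * s) v.
Proof. by rewrite /res_scale /residue /= coefM big_ord1 mulrA. Qed.
Fact res_scale1 : left_id 1 res_scale.
Proof. by move=> v; rewrite /res_scale /residue /= coef1 mul1r. Qed.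
Fact res_scaleDr : right_distributive res_scale +%R.
Proof. by move=> r u v; rewrite /res_scale -mulrDr. Qed.
Fact res_scaleDl v : {morph res_scale^~ v : r s / r + s}.
Proof. by move=> r s; rewrite /res_scale /residue /= coefD mulrDl. Qed.

HB.instance Definition _ := GRing.Zmodule_isLmodule.Build sgalg resfield
  res_scaleA res_scale1 res_scaleDr res_scaleDl.

(* k is concentrated in degree 0. *)
Definition res_homog (n : nat) (v : resfield) : Prop := v != 0 -> n = 0%N.

End SemigroupAlgebra.

(** * Graded free resolutions over k[S]

  [{ffun B d -> (sgalg k S)^o}] is the free module on the finite set [B d],
  graded by deg(t^m b) = m + deg b. *)

Section Resolution.
Variables (k : fieldType) (S : numSemigroup) (B : nat -> finType).
Variable deg : forall d, B d -> nat.
Local Notation R := (sgalg k S).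
Local Notation F d := {ffun B d -> R^o}.
Variable D : forall d, {linear F d.+1 -> F d}.

Definition homog d (n : nat) (f : F d) : Prop :=
  forall b m, (sgval (f b))`_m != 0 -> (m + deg b)%N = n.

Definition graded_free_resolution (M : lmodType R)
    (homogM : nat -> M -> Prop) : Prop :=
  [/\ forall d n (f : F d.+1), homog n f -> homog n (D d f),
      exists eps : {linear F 0 -> M},
        [/\ forall n (f : F 0), homog n f -> homogM n (eps f),
            forall v : M, exists f, eps f = v
          & forall f : F 0, eps f = 0 <-> exists g : F 1, f = D 0 g]
    & forall d (f : F d.+1), D d f = 0 <-> exists g : F d.+2, f = D d.+1 g].

Definition basis_elt d (b : B d) : F d := [ffun b' => ((b' == b)%:R : R)].

Definition minimal_resolution : Prop :=
  forall d (b : B d.+1) (b' : B d) (u : k),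
    u != 0 -> sgval (D d (basis_elt b) b') <> u%:P.

End Resolution.

(** * The modules F'_d and the maps between them *)

(* The multisets on {0,1,2} of size d with at most one copy of 0:
   see [in_bas]. *)
Definition bas (d : nat) : {fset {mset 'I_3}} :=
  [fset seq_mset (tval t) | t : d.-tuple 'I_3 &
     (count_mem ord0 t <= 1)%N]%fset.

Lemma in_bas d (c : {mset 'I_3}) :
  (c \in bas d) = (size c == d) && (c ord0 <= 1)%N.
Proof.
apply/imfsetP/andP => /= [[t] | [/eqP sc c0]].
  rewrite inE => t0 ->; rewrite mset_seqE t0.
  by rewrite (perm_size (perm_eq_seq_mset t)) size_tuple eqxx.
exists (tcast sc (in_tuple c)); last by rewrite val_tcast seq_mset_id.
by rewrite inE val_tcast count_mem_mset.
Qed.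

Definition Bas (d : nat) : finType := bas d.

Definition mset_deg (a : nat -> nat) (c : {mset 'I_3}) : nat :=
  (\sum_(i < 3) c i * a i)%N.

Definition bas_deg (a : nat -> nat) d (b : Bas d) : nat := mset_deg a (val b).

Section Complex.
Variables (k : fieldType) (S : numSemigroup) (a : nat -> nat).
Local Notation R := (sgalg k S).
Local Notation F d := {ffun Bas d -> R^o}.
Local Notation b := (apery_b a).

Definition sg_x (i : nat) : R := sg_mon k S (a i).
Local Notation x := sg_x.
Local Notation y := (sg_x 0).

(* The symbol e'_c of F'_d, which is 0 if c contains 0 more than once. *)
Definition e' d (c : {mset 'I_3}) : F d := [ffun s => ((val s == c)%:R : R)].

(* The symbol e'_{c - r + s}, which is 0 unless r is contained in c. *)
Definition e'rem d (c r s : {mset 'I_3}) : F d :=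
  if (r `<=` c)%mset then e' d ((c `\` r) `+` s)%mset else 0.

Local Notation i0 := (inord 0 : 'I_3).
Local Notation i1 := (inord 1 : 'I_3).
Local Notation i2 := (inord 2 : 'I_3).

(* The image in F'_d of e'_c, |c| = d + 1, so that (-1)^(|c| - 1) = (-1)^d. *)
Definition bd_sym d (c : {mset 'I_3}) : F d :=
  let tail := (-1) ^+ d *:
    (y *: e'rem d c [mset i0] mset0
     + y ^+ b 2 2 *: e'rem d c [mset i2; i2] [mset i0]) in
  if odd (c i2) then
    x 2 *: e'rem d c [mset i2] mset0 - x 1 *: e'rem d c [mset i1] mset0 + tail
  else
    x 2 *: e'rem d c [mset i2] mset0 + x 1 *: e'rem d c [mset i1] mset0
    - y ^+ b 1 1 *: e'rem d c [mset i1; i1] [mset i2] + tail.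

Definition bd d (f : F d.+1) : F d := \sum_s (f s : R) *: bd_sym d (val s).

Fact bd_linear d : linear (@bd d).
Proof.
move=> r f g; rewrite /bd scaler_sumr -big_split; apply: eq_bigr => s _ /=.
by rewrite !ffunE scalerDl scalerA.
Qed.

HB.instance Definition _ d :=
  GRing.isLinear.Build R (F d.+1) (F d) *:%R (@bd d) (@bd_linear d).

Definition bd_lin d : {linear F d.+1 -> F d} := @bd d.

End Complex.

(** * Consistency of the encodings *)

Section Checks.
Variables (k : fieldType) (S : numSemigroup) (a1 a2 a3 : nat).
Hypothesis mS : is_multiplicity S 4.
Hypothesis apS : apery S 4 =i [:: 0; a1; a2; a3].
Hypothesis h1 : a1 = 1 %[mod 4].
Hypothesis h2 : a2 = 2 %[mod 4].
Hypothesis h3 : a3 = 3 %[mod 4].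
Local Notation a := (apery_coord a1 a2 a3).

Lemma apery_coord_mod i : a i = i %[mod 4].
Proof.
rewrite /apery_coord -[RHS]modn_mod; have := ltn_pmod i (isT : 0 < 4)%N.
by move: (i %% 4)%N => [|[|[|[|]]]].
Qed.

Lemma apery_coord_in i : S (a i).
Proof.
have [_ S4 _] := mS.
have hin n : n \in [:: 0; a1; a2; a3] -> S n by rewrite -apS => /andP[].
rewrite /apery_coord; have := ltn_pmod i (isT : 0 < 4)%N.
by move: (i %% 4)%N => [|[|[|[|]]]] // _; apply: hin; rewrite !inE eqxx ?orbT.
Qed.

Lemma apery_coord_gt0 i : (0 < a i)%N.
Proof.
rewrite lt0n; apply/eqP=> a0; move: (apery_coord_mod i) a0.
rewrite /apery_coord -[in RHS]modn_mod; have := ltn_pmod i (isT : 0 < 4)%N.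
by move: (i %% 4)%N => [|[|[|[|]]]] //= _ e a0; rewrite a0 in e.
Qed.

(* Every positive element of S is a_i + s, with s in S. *)
Lemma apery_split n : S n -> (0 < n)%N ->
  exists2 i, (i < 4)%N & exists2 s, S s & n = (a i + s)%N.
Proof.
move=> Sn n0; have [/andP[le4 Sn4]|nap] := boolP ((4 <= n)%N && S (n - 4)%N).
  by exists 0%N => //; exists (n - 4)%N => //; rewrite subnKC.
have : n \in [:: 0; a1; a2; a3] by rewrite -apS; apply/andP.
rewrite !inE; case/or4P=> /eqP e; first by rewrite e in n0.
- by exists 1%N => //; exists 0%N; [apply: ns0 | rewrite addn0 e].
- by exists 2%N => //; exists 0%N; [apply: ns0 | rewrite addn0 e].
- by exists 3%N => //; exists 0%N; [apply: ns0 | rewrite addn0 e].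
Qed.

(* a_i is the least positive element of S in its class modulo 4. *)
Lemma apery_coord_min n i : S n -> (0 < n)%N -> n = i %[mod 4] -> (a i <= n)%N.
Proof.
elim/ltn_ind: n => n IH Sn n0 ni.
have [/andP[le4 Sn4]|nap] := boolP ((4 <= n)%N && S (n - 4)%N).
  have [n4|] := posnP (n - 4)%N.
    have en : n = 4%N by rewrite -(subnKC le4) n4.
    by rewrite /apery_coord -ni en.
  move=> n40; apply: leq_trans (IH _ _ Sn4 n40 _) (leq_subr _ _).
    by rewrite ltn_subrL n0.
  by rewrite -ni -[in RHS](subnK le4) modnDr.
have : n \in [:: 0; a1; a2; a3] by rewrite -apS; apply/andP.
rewrite !inE /apery_coord -ni.
by case/or4P=> /eqP e; [rewrite e in n0 | rewrite e h1 | rewrite e h2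
  | rewrite e h3].
Qed.

Lemma apery_bE i j :
  (4 * apery_b a i j)%N%:Z = (a i)%:Z + (a j)%:Z - (a (i + j)%N)%:Z.
Proof.
have hm : (a i + a j = i + j %[mod 4])%N.
  by rewrite -modnDm !apery_coord_mod modnDm.
have le : (a (i + j) <= a i + a j)%N.
  apply: apery_coord_min hm; first by apply: nsD; apply: apery_coord_in.
  by rewrite addn_gt0 apery_coord_gt0.
rewrite /apery_b mulnC divnK ?subzn ?PoszD //.
by rewrite -eqn_mod_dvd //; apply/eqP; rewrite hm apery_coord_mod.
Qed.

(* The kernel of k[S] -> k is the ideal generated by y, x_1, x_2, x_3. *)
Lemma residue_kernel (r : sgalg k S) :
  residue r = 0 <->
  exists c : 'I_4 -> sgalg k S, r = \sum_(i < 4) c i * sg_x k S a i.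
Proof.
pose I (r : sgalg k S) :=
  exists c : 'I_4 -> sgalg k S, r = \sum_(i < 4) c i * sg_x k S a i.
have I0 : I 0 by exists (fun=> 0); rewrite big1 // => i _; rewrite mul0r.
have ID r1 r2 : I r1 -> I r2 -> I (r1 + r2).
  move=> [c1 ->] [c2 ->]; exists (fun i => c1 i + c2 i).
  by rewrite -big_split; apply: eq_bigr => i _; rewrite mulrDl.
have Ix (i : 'I_4) s : I (s * sg_x k S a i).
  exists (fun j => if j == i then s else 0).
  rewrite (bigD1 i) //= eqxx big1 ?addr0 // => j /negPf->.
  by rewrite mul0r.
split=> [r0|[c ->]]; last first.
  rewrite /residue -[sgval _]/(val _) raddf_sum coef_sum big1 //= => i _.
  rewrite sg_mon_val ?apery_coord_in // coefMXn.
  by rewrite apery_coord_gt0.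
pose mono i : sgalg k S := insubd 0 ((sgval r)`_i *: 'X^i).
have monoE i : sgval (mono i) = (sgval r)`_i *: 'X^i.
  rewrite /mono -[sgval _]/(val _) val_insubd ifT //.
  apply/supp_inP=> j; rewrite coefZ coefXn; case: (eqVneq j i) => [->|_].
    by rewrite mulr1; have /supp_inP := sgvalP r; apply.
  by rewrite mulr0 eqxx.
have -> : r = \sum_(i < size (sgval r)) mono i.
  apply: val_inj; rewrite raddf_sum /= -[LHS]coefK poly_def.
  by apply: eq_bigr => i _; rewrite /= monoE.
apply: (big_ind I) => // i _.
have [ri0|ri0] := eqVneq (sgval r)`_i 0.
  suff -> : mono i = 0 by [].
  by apply: val_inj; rewrite /= monoE ri0 scale0r.
have Si : S i by have /supp_inP := sgvalP r; apply.
have i0 : (0 < i)%N by rewrite lt0n; apply: contraNneq ri0 => ->; apply/eqP.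
have [j j4 [s Ss eis]] := apery_split Si i0.
pose t : sgalg k S := insubd 0 ((sgval r)`_i *: 'X^s).
have tE : sgval t = (sgval r)`_i *: 'X^s.
  rewrite /t -[sgval _]/(val _) val_insubd ifT //.
  apply/supp_inP=> l; rewrite coefZ coefXn; case: (eqVneq l s) => [-> //|_].
  by rewrite mulr0 eqxx.
suff -> : mono i = t * sg_x k S a (Ordinal j4) by apply: Ix.
apply: val_inj; rewrite /= monoE tE sg_mon_val ?apery_coord_in //=.
by rewrite -scalerAl -exprD addnC -eis.
Qed.

End Checks.

(* Main.v *)
Require Import Defs.
From HB Require Import structures.
From mathcomp Require Import all_boot all_order all_algebra.
From mathcomp Require Import finmap multiset.
From mathcomp Require Import ring zify.
Import GRing.Theory.

Set Implicit Arguments.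
Unset Strict Implicit.
Unset Printing Implicit Defensive.

Local Open Scope mset_scope.
Local Open Scope ring_scope.

(** Write R for the semigroup algebra, p for y^b11 and q for y^b22.  Reading
  the degrees of the monomials gives x1^2 = p x2 and x2^2 = y q.

  A basis symbol of F'_d is determined by c0 in {0, 1} and by c2, since c1 is
  then forced.  So an element of F'_d is a pair of sequences (h, h') in R
  indexed by c2, where h carries the symbols with c0 = 0 and h' those with
  c0 = 1; only h_0, ..., h_d and h'_0, ..., h'_{d-1} count ([of_seqs_eq]).  In
  these coordinates the boundary is defined on infinite sequences by formulas
  that do not involve d except through the sign s = (-1)^d ([bd_of_seqs]):
    (h, h') |-> (M h + s y h', M h' + s q (shift^2 h)),
    (M h)_j = x2 h_{j+1} + (-1)^j x1 h_j - [j odd] p h_{j-1}.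
  The relation x1^2 = p x2 yields M M = x2^2 shift^2 = y q shift^2, and M
  commutes with shift^2.  This makes the boundary a differential: the complex
  is the cone of multiplication by y on a sequence of maps M that squares to
  zero only modulo y, the defect being absorbed by q shift^2.

  Exactness uses three facts about R, each read off from supports of
  polynomials in t: y is not a zero divisor; the annihilator of x2 modulo y is
  generated by x2 ([x2_ann]); the elements that multiply x1 into (y, x2) are
  those of (x1, x2, y) ([x1_ann]).  By the first fact it suffices to prove M
  exact modulo y ([cone_exact]).  There, a cycle g is made zero one entry at a
  time ([strand_map_exact_mod]): the equation for (M g)_0 puts g_0 in
  (x1, x2, y), and once g_0, ..., g_n vanish the equation for (M g)_n reads
  x2 g_{n+1} = 0 mod y, so that g_{n+1} is x2 v mod y; subtracting M of v
  placed in position n + 2 leaves the entries up to n unchanged.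

  Every entry of the boundary other than p is a multiple of x1, x2, y or q, and
  b22 > 0 because a2 > 4.  So the entries have zero constant term as soon as
  b11 > 0, whereas for b11 = 0 the symbol of the multiset {1, 1} is sent to
  x1 e'_1 - e'_2. *)
(** * The differential on coordinate sequences *)

Section Strand.
Variables (R : comNzRingType) (y x1 x2 p q : R).
Hypothesis x1_sqr : x1 * x1 = p * x2.
Hypothesis x2_sqr : x2 * x2 = y * q.

(** The part M of the boundary that preserves the number of copies of 0; the
  index j is the number of copies of 2 in the target symbol. *)
Definition strand_map (h : nat -> R) (j : nat) : R :=
  x2 * h j.+1 + (-1) ^+ j * (x1 * h j) - (if odd j then p * h j.-1 else 0).

Lemma strand_map_sqr h j : strand_map (strand_map h) j = y * (q * h j.+2).
Proof.
rewrite mulrA -x2_sqr /strand_map; case: j => [|j] /=; first ring: x1_sqr.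
rewrite !exprS -signr_odd negbK; case: (odd j) => /=; rewrite ?expr0 ?expr1;
  ring: x1_sqr.
Qed.

Lemma strand_mapD r h g j :
  strand_map (fun i => h i + r * g i) j = strand_map h j + r * strand_map g j.
Proof. by rewrite /strand_map; case: (odd j); ring. Qed.

Lemma strand_mapZ r g j : strand_map (fun i => r * g i) j = r * strand_map g j.
Proof. by rewrite /strand_map; case: (odd j); ring. Qed.

Lemma strand_map_shift h j : strand_map (fun i => h i.+2) j = strand_map h j.+2.
Proof.
case: j => [|j]; rewrite /strand_map !exprS /= ?negbK; first ring.
by case: (odd j); ring.
Qed.

(** The components of the boundary at the symbols with c0 = 0 and c0 = 1. *)
Definition cone0 s (h h' : nat -> R) j : R := strand_map h j + s * (y * h' j).
Definition cone1 s (h h' : nat -> R) j : R :=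
  strand_map h' j + s * (q * h j.+2).

Lemma eq_strand_map (h g : nat -> R) j :
  (forall i, (i <= j.+1)%N -> h i = g i) -> strand_map h j = strand_map g j.
Proof.
move=> e; rewrite /strand_map !e //.
exact: leq_trans (leq_pred j) (leqnSn j).
Qed.

Lemma cone0_sqr s h h' j : s * s = 1 ->
  cone0 (- s) (cone0 s h h') (cone1 s h h') j = 0.
Proof.
move=> ss; rewrite {1}/cone0 strand_mapD strand_map_sqr.
rewrite strand_mapZ /cone1; ring: ss.
Qed.

Lemma cone1_sqr s h h' j : s * s = 1 ->
  cone1 (- s) (cone0 s h h') (cone1 s h h') j = 0.
Proof.
move=> ss; rewrite {1}/cone1 strand_mapD strand_map_sqr.
rewrite strand_mapZ strand_map_shift /cone0; ring: ss.
Qed.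

Hypothesis y_reg : forall r, y * r = 0 -> r = 0.
Hypothesis x2_ann : forall r u, x2 * r = y * u ->
  exists v w, r = x2 * v + y * w.
Hypothesis x1_ann : forall r u v, x1 * r = x2 * u + y * v ->
  exists a b c, r = x1 * a + x2 * b + y * c.

(** The equation with index 0, which puts g_0 in (x1, x2, y), is available
  because the homological degree d + 1 of g is positive.  The construction of
  h and h' then adds one entry at a time. *)
Lemma strand_map_exact_mod d g :
    (forall j, (j <= d)%N -> exists u, strand_map g j = y * u) ->
  exists h h', forall j, (j <= d.+1)%N -> g j = strand_map h j + y * h' j.
Proof.
move=> cyc.
suff: forall n, (n <= d.+1)%N ->
  exists h h', forall j, (j <= n)%N -> g j = strand_map h j + y * h' j.
  by apply.
elim=> [_|n IHn nd].
  have [u eu] := cyc 0%N isT.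
  have [|a [b [c ec]]] := @x1_ann (g 0%N) (- g 1%N) u.
    move: eu; rewrite /strand_map /= expr0 => <-; ring.
  exists (fun j => if j == 0%N then a else b), (fun=> c) => [[|//]] _.
  by rewrite ec /strand_map /=; ring.
have [h [h' eh]] := IHn (ltnW nd).
have [u eu] := cyc n nd.
(* The remainder f vanishes up to n, so (M f)_n only sees x2 f_{n+1}. *)
pose f i := g i + -1 * (strand_map h i + y * h' i).
have f0 i : (i <= n)%N -> f i = 0 by move=> le_in; rewrite /f eh //; ring.
have ef : strand_map f n = x2 * f n.+1.
  by rewrite {1}/strand_map (f0 n) // (f0 n.-1) ?leq_pred //; case: odd; ring.
have er : x2 * f n.+1 = y * (u - q * h n.+2 - strand_map h' n).
  by rewrite -ef strand_mapD eu strand_mapD strand_map_sqr; ring.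
have [v [w erw]] := x2_ann er.
exists (fun i => h i + (if i == n.+2 then v else 0)).
exists (fun i => h' i + (if i == n.+1 then w else 0)) => j.
rewrite leq_eqVlt => /orP[/eqP->|jn].
  have -> : g n.+1 = strand_map h n.+1 + y * h' n.+1 + f n.+1.
    by rewrite /f; ring.
  rewrite erw /strand_map /= !eqxx (ltn_eqF (ltnSn _)).
  rewrite (ltn_eqF (leqW (ltnSn n))) /= !addr0.
  by case: odd; ring.
rewrite eh // (ltn_eqF jn) addr0; congr (_ + _); apply: eq_strand_map => i ij.
by rewrite ltn_eqF ?addr0 // (leq_ltn_trans ij).
Qed.

(** The equations with c0 = 0 alone suffice.  They make h a cycle modulo y, so
  that h = M g + y l; then (g, -s l) has the right first component, and the
  second one is right after multiplication by y, hence right. *)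
Lemma cone_exact d s h h' : s * s = 1 ->
    (forall j, (j <= d)%N -> cone0 s h h' j = 0) ->
  exists g g', (forall j, (j <= d.+1)%N -> h j = cone0 (- s) g g' j)
    /\ (forall j, (j <= d)%N -> h' j = cone1 (- s) g g' j).
Proof.
move=> ss cyc.
have [|g [l eg]] := @strand_map_exact_mod d h.
  move=> j /cyc e; exists (- s * h' j).
  by apply: subr0_eq; rewrite -e /cone0; ring.
exists g, (fun j => - s * l j); split=> j jd.
  by rewrite /cone0 eg //=; ring: ss.
apply/eqP; rewrite -subr_eq0; apply/eqP/y_reg.
have : strand_map h j = y * (q * g j.+2) + y * strand_map l j.
  rewrite -strand_map_sqr -strand_mapD; apply: eq_strand_map => i ij.
  by apply: eg; apply: leq_trans ij _.
rewrite /cone1 strand_mapZ.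
have e := cyc j jd; move: e; rewrite /cone0 => e eh.
rewrite eh in e.
rewrite -[LHS]mul1r -ss -[RHS](mulr0 s) -e; ring: ss.
Qed.
End Strand.

(** * The semigroup algebra *)

Section SemigroupAlgebra.
Variables (k : fieldType) (S : numSemigroup).
Local Notation R := (sgalg k S).

Lemma sgalg_eq (r s : R) : (forall i, (sgval r)`_i = (sgval s)`_i) -> r = s.
Proof. by move=> e; apply: val_inj; apply/polyP. Qed.

Lemma sg_monD m n : S m -> S n ->
  sg_mon k S (m + n) = sg_mon k S m * sg_mon k S n.
Proof.
by move=> Sm Sn; apply: val_inj; rewrite /= !sg_mon_val ?exprD //; apply: nsD.
Qed.

Lemma sg_mon0 : sg_mon k S 0 = 1.
Proof. by apply: val_inj; rewrite /= sg_mon_val ?expr0 //; apply: ns0. Qed.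

Lemma nsM m n : S m -> S (m * n)%N.
Proof.
move=> Sm; elim: n => [|n IHn]; first by rewrite muln0; apply: ns0.
by rewrite mulnS; apply: nsD.
Qed.

Lemma sg_monX m n : S m -> sg_mon k S (m * n) = sg_mon k S m ^+ n.
Proof.
move=> Sm; elim: n => [|n IHn]; first by rewrite muln0 sg_mon0.
by rewrite mulnS exprS -IHn sg_monD //; apply: nsM.
Qed.

Lemma coef_sg_monM m (r : R) i : S m ->
  (sgval (sg_mon k S m * r))`_i = if (i < m)%N then 0 else (sgval r)`_(i - m).
Proof. by move=> Sm; rewrite /= sg_mon_val // mulrC coefMXn. Qed.

Lemma coef_sgD (r s : R) i : (sgval (r + s))`_i = (sgval r)`_i + (sgval s)`_i.
Proof. by rewrite /= coefD. Qed.

Lemma coef_sgN (r : R) i : (sgval (- r))`_i = - (sgval r)`_i.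
Proof. by rewrite /= coefN. Qed.

Lemma supp_sgval (r : R) i : ~~ S i -> (sgval r)`_i = 0.
Proof.
move=> nSi; apply/eqP; apply: contraNT nSi.
by have /supp_inP := sgvalP r; apply.
Qed.

Lemma sg_mon_inj m (r : R) : S m -> sg_mon k S m * r = 0 -> r = 0.
Proof.
move=> Sm e; apply: sgalg_eq => i.
have := coef_sg_monM r (i + m) Sm.
by rewrite e /= coef0 ltnNge leq_addl addnK /= => <-; rewrite coef0.
Qed.

(** Division with remainder by a monomial: the remainder keeps the part of r
  supported outside the ideal m + S of S. *)
Lemma sg_mon_quotient m (r : R) : S m -> exists u : R, forall i,
  (sgval (r - sg_mon k S m * u))`_i =
    if (m <= i)%N && S (i - m)%N then 0 else (sgval r)`_i.
Proof.
move=> Sm.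
pose f i := if S i then (sgval r)`_(i + m) else 0.
have fE i : (\poly_(i < size (sgval r)) f i)`_i = f i.
  rewrite coef_poly; case: ltnP => // sz; rewrite /f nth_default ?if_same //.
  exact: leq_trans sz (leq_addr _ _).
have fin : \poly_(i < size (sgval r)) f i \in supp_in (k := k) S.
  by apply/supp_inP => i; rewrite fE /f; case: ifP => //; rewrite eqxx.
exists (SgAlg fin) => i.
rewrite coef_sgD coef_sgN coef_sg_monM // ltnNge; case: leqP => /= mi.
  rewrite fE /f subnK //; case: ifP => _; first exact: subrr.
  exact: subr0.
exact: subr0.
Qed.

Lemma supp_two_monomials m n (r : R) : S m -> S n ->
    (forall i, S i -> ~~ ((m <= i)%N && S (i - m)%N) ->
       ~~ ((n <= i)%N && S (i - n)%N) -> (sgval r)`_i = 0) ->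
  exists u v, r = sg_mon k S m * u + sg_mon k S n * v.
Proof.
move=> Sm Sn r0; have [u eu] := sg_mon_quotient r Sm.
have [v coef_at] := sg_mon_quotient (r - sg_mon k S m * u) Sn.
exists u, v; apply/eqP; rewrite -subr_eq0 opprD addrA; apply/eqP.
apply: sgalg_eq => i; rewrite coef_at eu /= coef0.
case: ifPn => // i_n; case: ifPn => // i_m.
by have [Si|/supp_sgval->] := boolP (S i); first exact: r0.
Qed.

Lemma residueM (r s : R) : residue (r * s) = residue r * residue s.
Proof. by rewrite /residue /= coefM big_ord1. Qed.

Lemma residueD (r s : R) : residue (r + s) = residue r + residue s.
Proof. by rewrite /residue coef_sgD. Qed.

Lemma residue_mon m : (0 < m)%N -> S m -> residue (sg_mon k S m) = 0.
Proof.
by move=> m0 Sm; rewrite /residue sg_mon_val // coefXn eq_sym gtn_eqF.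
Qed.

Definition sg_homog (w : nat) (r : R) := forall i, (sgval r)`_i != 0 -> i = w.

Lemma sg_homog_mon w : S w -> sg_homog w (sg_mon k S w).
Proof.
move=> Sw i; rewrite sg_mon_val // coefXn.
by case: (i =P w) => //; rewrite eqxx.
Qed.

Lemma coefM_neq0 (r s : R) i : (sgval (r * s))`_i != 0 ->
  exists j l, [/\ i = (j + l)%N, (sgval r)`_j != 0 & (sgval s)`_l != 0].
Proof.
rewrite /= coefM => nz.
have [/existsP[j /andP[rj sj]]|none] :=
  boolP [exists j : 'I_i.+1, ((sgval r)`_j != 0) && ((sgval s)`_(i - j) != 0)].
  by exists j, (i - j)%N; rewrite subnKC // leq_ord.
case/eqP: nz; apply: big1 => j _; apply/eqP; rewrite mulf_eq0.
by apply: contraNT none; rewrite negb_or => ?; apply/existsP; exists j.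
Qed.

Lemma sg_homogM w v r s :
  sg_homog w r -> sg_homog v s -> sg_homog (w + v) (r * s).
Proof. by move=> hr hs i /coefM_neq0[j [l [-> /hr-> /hs->]]]. Qed.

Lemma sg_homog_nat n : sg_homog 0 (n%:R : R).
Proof.
move=> i; rewrite -[sgval _]/(val _) rmorph_nat -polyC_natr coefC.
by case: i => //= i; rewrite eqxx.
Qed.

Lemma sg_homog_sign n : sg_homog 0 ((-1) ^+ n : R).
Proof.
move=> i; rewrite -[sgval _]/(val _) rmorphXn rmorphN1 /= -polyC1 -polyCN.
by rewrite -rmorphXn coefC; case: i => //= i; rewrite eqxx.
Qed.

(** The shape is that of [bd_coef], for use both in a given degree and at the
  constant term. *)
Lemma coef_bd_sum0 (A B C D E : R) m : (sgval A)`_m = 0 -> (sgval B)`_m = 0 ->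
    (sgval C)`_m = 0 -> (sgval D)`_m = 0 -> (sgval E)`_m = 0 ->
  (sgval (A + B - C + (D + E)))`_m = 0.
Proof.
by rewrite !coef_sgD coef_sgN => -> -> -> -> ->; rewrite subr0 !addr0.
Qed.
End SemigroupAlgebra.

(** * Multiplicity four: the relations of the algebra, and its colon ideals *)

Section MultiplicityFour.
Variables (k : fieldType) (S : numSemigroup) (a1 a2 a3 : nat).
Hypothesis mS : is_multiplicity S 4.
Hypothesis apS : apery S 4 =i [:: 0%N; a1; a2; a3].
Hypothesis h1 : (a1 = 1 %[mod 4])%N.
Hypothesis h2 : (a2 = 2 %[mod 4])%N.
Hypothesis h3 : (a3 = 3 %[mod 4])%N.
Local Notation R := (sgalg k S).
Local Notation a := (apery_coord a1 a2 a3).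
Local Notation x := (sg_x k S a).
Local Notation y := (sg_x k S a 0).
Local Notation p := (y ^+ apery_b a 1 1).
Local Notation q := (y ^+ apery_b a 2 2).

Let Sa i : S (a i) := apery_coord_in mS apS i.

Lemma a2_gt4 : (4 < a2)%N.
Proof.
have [_ _ m4] := mS; have S2 : S a2 by exact: (Sa 2).
have := m4 _ S2 (apery_coord_gt0 h1 h2 h3 2).
rewrite leq_eqVlt => /orP[/eqP e|//].
by move: h2; rewrite -[a2]e.
Qed.

Lemma b22_gt0 : (0 < apery_b a 2 2)%N.
Proof.
have := apery_bE mS apS h1 h2 h3 2 2; have := a2_gt4.
rewrite /apery_coord /=; lia.
Qed.

Lemma x1_sqr : x 1 * x 1 = p * x 2.
Proof.
rewrite /sg_x -sg_monX // -!sg_monD //; last exact: nsM.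
congr sg_mon; have := apery_bE mS apS h1 h2 h3 1 1.
rewrite /apery_coord /=; lia.
Qed.

Lemma x2_sqr : x 2 * x 2 = y * q.
Proof.
rewrite /sg_x -sg_monX // -!sg_monD //; last exact: nsM.
congr sg_mon; have := apery_bE mS apS h1 h2 h3 2 2.
rewrite /apery_coord /=; lia.
Qed.

Hypothesis hsum : (a3 = a1 + a2)%N.

Lemma x3E : x 3 = x 1 * x 2.
Proof. by rewrite /sg_x -sg_monD // /apery_coord /= hsum. Qed.

Lemma y_reg (r : R) : y * r = 0 -> r = 0.
Proof. exact: sg_mon_inj. Qed.

Lemma coef_y_apery (r : R) i :
  i \in [:: 0%N; a1; a2; a3] -> (sgval (y * r))`_i = 0.
Proof.
rewrite -apS => /andP[_ ni]; rewrite coef_sg_monM //= ltnNge.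
by case: leqP ni => //= _; apply: supp_sgval.
Qed.

(** Multiplication by x2 moves the coefficients of r at 0 and a1 to the Apery
  elements a2 and a3, where every multiple of y vanishes.  What remains of r is
  supported on a2, a3 and 4 + S, that is, on multiples of x2 or y. *)
Lemma x2_ann (r u : R) : x 2 * r = y * u -> exists v w, r = x 2 * v + y * w.
Proof.
move=> e; apply: supp_two_monomials => // i Si n2 n0.
have : i \in [:: 0%N; a1; a2; a3] by rewrite -apS; apply/andP.
have coef j : (j + a2 \in [:: 0; a1; a2; a3])%N -> (sgval r)`_j = 0.
  move/(coef_y_apery u); rewrite -e coef_sg_monM // /= ltnNge.
  by rewrite /apery_coord /= leq_addl addnK.
rewrite !inE; case/or4P=> /eqP ei.
- by rewrite ei; apply: coef; rewrite add0n !inE eqxx !orbT.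
- by rewrite ei; apply: coef; rewrite -hsum !inE eqxx !orbT.
- by case/negP: n2; rewrite ei /apery_coord /= leqnn subnn; apply: ns0.
case/negP: n2; rewrite ei hsum /apery_coord /= leq_addl addnK; exact: (Sa 1).
Qed.

(** The generator x3 = x1 x2 of the maximal ideal is redundant. *)
Lemma residue0P (r : R) :
  residue r = 0 <-> exists u v w, r = x 1 * u + x 2 * v + y * w.
Proof.
split=> [/(residue_kernel mS apS h1 h2 h3)[c]|[u [v [w ->]]]].
  rewrite !big_ord_recl big_ord0 /= => ->.
  pose j1 : 'I_4 := lift ord0 ord0.
  pose j2 : 'I_4 := lift ord0 (lift ord0 ord0).
  pose j3 : 'I_4 := lift ord0 (lift ord0 (lift ord0 ord0)).
  exists (c j1 + c j3 * x 2), (c j2), (c ord0); rewrite /bump /= x3E; ring.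
have x0 i : residue (x i) = 0.
  by rewrite residue_mon ?(apery_coord_gt0 h1 h2 h3).
by rewrite !residueD !residueM !x0 !mul0r !addr0.
Qed.

(** Compare coefficients at a1.  The coefficient of x1 r is the constant term
  of r, that of y v vanishes since a1 is an Apery element, and that of x2 u
  vanishes because a1 - a2, being congruent to 3, cannot be in S: it would be
  at least a3 > a1. *)
Lemma x1_ann (r u v : R) : x 1 * r = x 2 * u + y * v ->
  exists b c d, r = x 1 * b + x 2 * c + y * d.
Proof.
move=> e; apply/residue0P; rewrite /residue.
have -> : (sgval r)`_0 = (sgval (x 1 * r))`_a1.
  by rewrite coef_sg_monM // /apery_coord /= ltnn subnn.
rewrite e coef_sgD coef_y_apery ?inE ?eqxx ?orbT // addr0 coef_sg_monM //.
rewrite /apery_coord /= ltnNge; case: leqP => //= le21.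
apply: supp_sgval; apply/negP => S12.
have n12 : (a1 - a2)%N = 3 %[mod 4] by lia.
have := apery_coord_min apS h1 h2 h3 S12 _ n12.
have := a2_gt4; rewrite /apery_coord /=; lia.
Qed.
End MultiplicityFour.

(** * Multisets on three letters *)

Local Notation i0 := (inord 0 : 'I_3).
Local Notation i1 := (inord 1 : 'I_3).
Local Notation i2 := (inord 2 : 'I_3).
Local Notation ms := {mset 'I_3}.

Lemma ord3E : [/\ i0 = 0 :> nat, i1 = 1 :> nat & i2 = 2 :> nat]%N.
Proof. by rewrite !inordK. Qed.

Lemma ord3_ind (P : 'I_3 -> Prop) : P i0 -> P i1 -> P i2 -> forall i, P i.
Proof.
have [e0 e1 e2] := ord3E; move=> P0 P1 P2 [[|[|[|//]]] lt_i].
- by rewrite (_ : Ordinal _ = i0) //; apply: val_inj; rewrite /= e0.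
- by rewrite (_ : Ordinal _ = i1) //; apply: val_inj; rewrite /= e1.
- by rewrite (_ : Ordinal _ = i2) //; apply: val_inj; rewrite /= e2.
Qed.

Lemma big_ord3 (T : Type) (idx : T) (op : Monoid.law idx) (F : 'I_3 -> T) :
  \big[op/idx]_i F i = op (F i0) (op (F i1) (F i2)).
Proof.
have [e0 e1 e2] := ord3E.
rewrite !big_ord_recl big_ord0 Monoid.mulm1.
by congr (op (F _) (op (F _) (F _))); apply: val_inj; rewrite /= ?e0 ?e1 ?e2.
Qed.

Lemma ord3_eqE : (i0 == i1 = false) * (i0 == i2 = false) * (i1 == i0 = false)
  * (i1 == i2 = false) * (i2 == i0 = false) * (i2 == i1 = false).
Proof. by rewrite -!val_eqE /= !inordK. Qed.

Lemma eq_mset3 (c e : ms) :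
  c i0 = e i0 -> c i1 = e i1 -> c i2 = e i2 -> c = e.
Proof. by move=> *; apply/msetP; apply: ord3_ind. Qed.

Lemma size_mset3 (c : ms) : size c = (c i0 + c i1 + c i2)%N.
Proof.
rewrite -!count_mem_mset; elim: {c}(c : seq _) => //= i s ->.
by move: i; apply: ord3_ind; rewrite !eqxx !ord3_eqE; lia.
Qed.

Lemma in_bas3 d (c : ms) :
  (c \in bas d) = (c i0 + c i1 + c i2 == d)%N && (c i0 <= 1)%N.
Proof.
rewrite in_bas size_mset3; congr (_ && (c _ <= _)%N).
by apply: val_inj; rewrite /= inordK.
Qed.

(** Replacing r by t is undone by replacing t by r.  This converts the boundary
  of each symbol into the list of symbols whose boundary contains a given
  one. *)
Lemma mset_exchange (r t c e : ms) :
  (r `<=` c) && (e == (c `\` r) `+` t) = (t `<=` e) && (c == (e `\` t) `+` r).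
Proof.
apply/andP/andP=> -[/msubsetP s /eqP->]; split; try apply/msubsetP => i;
  try apply/eqP/msetP => i; rewrite !msetE2; have := s i; lia.
Qed.

Lemma mset_degE a (c : ms) :
  mset_deg a c = (c i0 * a 0 + c i1 * a 1 + c i2 * a 2)%N.
Proof. by rewrite /mset_deg big_ord3 /= !inordK // addnA. Qed.

(** * The boundary in coordinates *)

(** The two parity cases of the boundary merge into one formula, with the sign
  (-1)^c2 in front of x1 and a term in p that is present for c2 even. *)
Lemma ffun_bd_sym (R : comNzRingType) (T : finType) (x1 x2 y p q e : R)
    (odd_c : bool) (E2 E1 E11 E0 E22 : {ffun T -> R^o}) t :
  (if odd_c then x2 *: E2 - x1 *: E1 + e *: (y *: E0 + q *: E22)
   else x2 *: E2 + x1 *: E1 - p *: E11 + e *: (y *: E0 + q *: E22)) t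
  = x2 * E2 t + (-1) ^+ odd_c * x1 * E1 t - (~~ odd_c)%:R * p * E11 t
    + (e * y * E0 t + e * q * E22 t) :> R.
Proof. by case: odd_c; rewrite !ffunE /GRing.scale /= ?expr0 ?expr1; ring. Qed.

Lemma ffun_scale (R : comNzRingType) (T : finType) (r : R)
  (g : {ffun T -> R^o}) t : (r *: g) t = r * g t :> R.
Proof. by rewrite ffunE. Qed.

Lemma mulr_bd_sym (R : comNzRingType) 
    (r c2 c1 c11 c0 c22 E2 E1 E11 E0 E22 : R) :
  r * (c2 * E2 + c1 * E1 - c11 * E11 + (c0 * E0 + c22 * E22)) =
  r * (c2 * E2) + r * (c1 * E1) - r * (c11 * E11)
  + (r * (c0 * E0) + r * (c22 * E22)).
Proof. ring. Qed.

Section Boundary.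
Variables (k : fieldType) (S : numSemigroup).
Local Notation R := (sgalg k S).
Local Notation F d := {ffun Bas d -> R^o}.

(** The value 0 outside the basis agrees with the convention that the symbol of
  a multiset with repeated 0 vanishes, so that boundary formulas need no case
  distinction. *)
Definition coef_at d (f : F d) (c : ms) : R :=
  \sum_s (f s : R) * (val s == c)%:R.

Lemma coef_at_val d (f : F d) (s : Bas d) : coef_at f (val s) = f s.
Proof.
rewrite /coef_at (bigD1 s) //= eqxx mulr1 big1 ?addr0 // => u /eqP us.
by case: eqP => [/val_inj|_]; last exact: mulr0.
Qed.

Lemma coef_at_out d (f : F d) (c : ms) : c \notin bas d -> coef_at f c = 0.
Proof.
move=> nc; rewrite /coef_at big1 // => s _.
by case: eqP nc => [<- /negP[]|_ _]; [exact: valP | exact: mulr0].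
Qed.

(** The contribution to the boundary, at c, of the symbols that reach c when r
  is replaced by t; the coefficient phi may depend on the source symbol. *)
Definition bd_term d (f : F d) (phi : ms -> R) (r t c : ms) : R :=
  if t `<=` c then phi ((c `\` t) `+` r) * coef_at f ((c `\` t) `+` r) else 0.

Lemma sum_e'rem d (f : F d.+1) phi r t (s : Bas d) :
  \sum_u (f u : R) * (phi (val u) * (e'rem k S d (val u) r t s : R))
  = bd_term f phi r t (val s).
Proof.
have e'E c : (e'rem k S d c r t s : R)
    = ((t `<=` val s) && (c == (val s `\` t) `+` r))%:R.
  by rewrite -mset_exchange /e'rem; case: ifP => _; rewrite !ffunE.
rewrite /bd_term; case: ifP => ts; last first.
  by rewrite big1 // => u _; rewrite e'E ts mulr0 mulr0.
rewrite /coef_at big_distrr /=; apply: eq_bigr => u _; rewrite e'E ts /=.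
by case: eqP => [->|_]; rewrite ?mulr1 ?mulr0 // mulrC.
Qed.

Variable a : nat -> nat.
Local Notation x := (sg_x k S a).
Local Notation y := (sg_x k S a 0).
Local Notation p := (y ^+ apery_b a 1 1).
Local Notation q := (y ^+ apery_b a 2 2).

Lemma bd_symE d c (s : Bas d) : (bd_sym k S a d c s : R) =
  x 2 * e'rem k S d c [mset i2] mset0 s
  + (-1) ^+ (c i2) * x 1 * e'rem k S d c [mset i1] mset0 s
  - (~~ odd (c i2))%:R * p * e'rem k S d c [mset i1; i1] [mset i2] s
  + ((-1) ^+ d * y * e'rem k S d c [mset i0] mset0 s
     + (-1) ^+ d * q * e'rem k S d c [mset i2; i2] [mset i0] s).
Proof. by rewrite -signr_odd; apply: ffun_bd_sym. Qed.

(** The transpose of the defining formula: each coefficient of the boundary as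
  a sum of five terms. *)
Lemma bd_coef d (f : F d.+1) (s : Bas d) : (bd a f s : R) =
  bd_term f (fun=> x 2) [mset i2] mset0 (val s)
  + bd_term f (fun c => (-1) ^+ (c i2) * x 1) [mset i1] mset0 (val s)
  - bd_term f (fun c => (~~ odd (c i2))%:R * p) [mset i1; i1] [mset i2] (val s)
  + (bd_term f (fun c => (-1) ^+ d * y) [mset i0] mset0 (val s)
     + bd_term f (fun c => (-1) ^+ d * q) [mset i2; i2] [mset i0] (val s)).
Proof.
rewrite /bd sum_ffunE.
have sum_split (A B C D E : Bas d.+1 -> R) :
    \sum_u (A u + B u - C u + (D u + E u)) =
    \sum_u A u + \sum_u B u - \sum_u C u + (\sum_u D u + \sum_u E u).
  by rewrite big_split sumrB /= !big_split.
pose E r t c : R := e'rem k S d c r t s.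
transitivity (\sum_u ((f u : R) * (x 2 * E [mset i2] mset0 (val u))
  + (f u : R) * ((-1) ^+ (val u i2) * x 1 * E [mset i1] mset0 (val u))
  - (f u : R) * ((~~ odd (val u i2))%:R * p * E [mset i1; i1] [mset i2] (val u))
  + ((f u : R) * ((-1) ^+ d * y * E [mset i0] mset0 (val u))
    + (f u : R) * ((-1) ^+ d * q * E [mset i2; i2] [mset i0] (val u))))).
  apply: eq_bigr => u _; apply: etrans (ffun_scale _ _ _) _.
  rewrite bd_symE; exact: mulr_bd_sym.
rewrite sum_split; congr (_ + _ - _ + (_ + _)).
exact: (sum_e'rem f (fun=> x 2)).
exact: (sum_e'rem f (fun c => (-1) ^+ (c i2) * x 1)).
exact: (sum_e'rem f (fun c => (~~ odd (c i2))%:R * p)).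
exact: (sum_e'rem f (fun=> (-1) ^+ d * y)).
exact: (sum_e'rem f (fun=> (-1) ^+ d * q)).
Qed.

Definition seq_at (h h' : nat -> R) (c : ms) : R :=
  if c i0 == 0%N then h (c i2) else h' (c i2).

(** Only the entries h_j with j <= d and h'_j with j < d are used; leaving the
  others free makes the boundary independent of d, up to sign. *)
Definition of_seqs d h h' : F d :=
  [ffun s : Bas d => (seq_at h h' (val s) : R^o)].

Lemma coef_at_of_seqs d h h' c :
  coef_at (of_seqs d h h') c = if c \in bas d then seq_at h h' c else 0.
Proof.
case: ifPn => [cd|]; last exact: coef_at_out.
by rewrite -[c]/(val [` cd]%fset) coef_at_val ffunE.
Qed.

Definition mset3 c0 c1 c2 : ms := (msetn c0 i0 `+` msetn c1 i1) `+` msetn c2 i2.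

Lemma mset3E c0 c1 c2 :
  (mset3 c0 c1 c2 i0 = c0) * (mset3 c0 c1 c2 i1 = c1)
  * (mset3 c0 c1 c2 i2 = c2).
Proof. by rewrite !msetE2 !msetnE !eqxx !ord3_eqE !addn0. Qed.

Lemma mset3_bas c0 c1 c2 :
  (c0 <= 1)%N -> mset3 c0 c1 c2 \in bas (c0 + c1 + c2)%N.
Proof. by move=> c01; rewrite in_bas3 !mset3E eqxx. Qed.

Lemma of_seqs_eq d h h' g g' :
  of_seqs d h h' = of_seqs d g g' <->
  (forall j, (j <= d)%N -> h j = g j) /\ (forall j, (j < d)%N -> h' j = g' j).
Proof.
split=> [e|[e e']].
  have eq_at c : coef_at (of_seqs d h h') c = coef_at (of_seqs d g g') c.
    by rewrite e.
  split=> j jd.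
    have := eq_at (mset3 0 (d - j)%N j).
    have := mset3_bas (d - j)%N j (leq0n 1).
    by rewrite add0n subnK // !coef_at_of_seqs => ->; rewrite /seq_at !mset3E.
  have := eq_at (mset3 1 (d.-1 - j)%N j).
  have := mset3_bas (d.-1 - j)%N j (leqnn 1).
  rewrite (_ : _ + j = d)%N; last by lia.
  by rewrite !coef_at_of_seqs => ->; rewrite /seq_at !mset3E.
apply/ffunP=> s; rewrite !ffunE /seq_at; have := valP s; rewrite in_bas3.
move: (val s) => c /andP[/eqP cd c0].
by case: eqP => c0'; [apply: e | apply: e']; lia.
Qed.

Lemma of_seqs_onto d (f : F d) : exists h h', f = of_seqs d h h'.
Proof.
exists (fun j => coef_at f (mset3 0 (d - j)%N j)).
exists (fun j => coef_at f (mset3 1 (d.-1 - j)%N j)).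
apply/ffunP=> s; rewrite ffunE -coef_at_val /seq_at.
have := valP s; rewrite in_bas3.
move: (val s) => c /andP[/eqP cd c0].
by case: eqP => c0'; congr coef_at; apply: eq_mset3; rewrite mset3E; lia.
Qed.

Lemma bd_of_seqs d h h' :
  bd a (of_seqs d.+1 h h') =
  of_seqs d (cone0 y (x 1) (x 2) p ((-1) ^+ d) h h')
            (cone1 (x 1) (x 2) p q ((-1) ^+ d) h h').
Proof.
apply/ffunP=> s; rewrite bd_coef ffunE; have := valP s; rewrite in_bas3.
move: (val s) => c /andP[/eqP cd c0].
have boolM (b : bool) (r r' : R) : b%:R * r * r' = if b then r * r' else 0.
  by case: b; rewrite ?mul1r ?mul0r.
rewrite /bd_term !msub0set !msub1set !in_mset !coef_at_of_seqs !in_bas3 /seq_at.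
rewrite !msetE2 !msetnE !mset0E !eqxx !ord3_eqE !(addn0, add0n, subn0) !boolM.
rewrite /cone0 /cone1 /strand_map.
move: (c i0) (c i1) (c i2) cd c0 => [|[|//]] c1 c2 cd _;
  change nat in (type of c1); change nat in (type of c2);
  case: c2 cd => [|c2] cd /=; rewrite ?subnn ?subn1 ?andbT ?andbF /=;
  try case: (odd c2); rewrite /= !ifT; try lia.
all: by rewrite -?mulrA ?(addn0, addn1, addn2) ?mulr0 ?add0r ?addr0 ?subr0.
Qed.
End Boundary.

(** * Degrees and constant terms of the boundary *)

Lemma bd_term_homog k S a d (f : {ffun Bas d -> (sgalg k S)^o}) n w phi r t c :
    homog (@bas_deg a) n f -> (forall e, sg_homog w (phi e)) ->
    (t `<=` c -> mset_deg a ((c `\` t) `+` r) = (mset_deg a c + w)%N) ->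
  forall m, (sgval (bd_term f phi r t c))`_m != 0 -> (m + mset_deg a c = n)%N.
Proof.
move=> hf hphi; rewrite /bd_term.
case: ifP => [_ /(_ isT) hdeg m|_ _ m]; last first.
  by rewrite coef0 eqxx.
set e := (c `\` t) `+` r in hdeg *.
have [eb|/coef_at_out->] := boolP (e \in bas d); last first.
  by rewrite mulr0 coef0 eqxx.
move=> /coefM_neq0[j [l [-> /hphi->]]].
rewrite -[e]/(val [` eb]%fset) coef_at_val => /hf <-.
by rewrite /bas_deg [val _]/= hdeg; lia.
Qed.

Lemma residue_bd_term k S d (f : {ffun Bas d -> (sgalg k S)^o}) phi r t c :
  (forall e, residue (phi e) = 0) -> residue (bd_term f phi r t c) = 0.
Proof.
move=> phi0; rewrite /bd_term; case: ifP => _.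
  by rewrite residueM phi0 mul0r.
by rewrite /residue coef0.
Qed.

(** * The augmentation *)

Section Augmentation.
Variables (k : fieldType) (S : numSemigroup).
Local Notation R := (sgalg k S).
Local Notation F d := {ffun Bas d -> R^o}.

Definition bas_empty : Bas 0 := [` mset3_bas 0 0 (leq0n 1)]%fset.

Definition augmentation (f : F 0) : resfield k S := residue (f bas_empty : R).

Fact augmentation_linear : linear augmentation.
Proof.
move=> r f g; rewrite /augmentation [(_ + _ : F 0) _]ffunE residueD.
congr (_ + _).
by rewrite [(_ *: _ : F 0) _]ffunE; apply: residueM.
Qed.

HB.instance Definition _ :=
  GRing.isLinear.Build R (F 0) (resfield k S) *:%R augmentation
    augmentation_linear.

Lemma augmentation_of_seqs h h' :
  augmentation (of_seqs 0 h h') = residue (h 0%N : R).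
Proof. by rewrite /augmentation ffunE /seq_at /= !mset3E. Qed.

Fact polyC_supp (v : k) : v%:P \in supp_in (k := k) S.
Proof.
by apply/supp_inP => -[|i]; rewrite ?ns0 // coefC eqxx.
Qed.
End Augmentation.

(** * The bd_resolution *)

Section Main.
Variables (k : fieldType) (S : numSemigroup) (a1 a2 a3 : nat).
Hypothesis mS : is_multiplicity S 4.
Hypothesis apS : apery S 4 =i [:: 0%N; a1; a2; a3].
Hypothesis h1 : (a1 = 1 %[mod 4])%N.
Hypothesis h2 : (a2 = 2 %[mod 4])%N.
Hypothesis h3 : (a3 = 3 %[mod 4])%N.
Local Notation R := (sgalg k S).
Local Notation F d := {ffun Bas d -> R^o}.
Local Notation a := (apery_coord a1 a2 a3).
Local Notation x := (sg_x k S a).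
Local Notation y := (sg_x k S a 0).
Local Notation b := (apery_b a).

Let Sa i : S (a i) := apery_coord_in mS apS i.

Lemma y_expE n : y ^+ n = sg_mon k S (4 * n).
Proof. by rewrite /sg_x -sg_monX. Qed.

Lemma S4M n : S (4 * n)%N.
Proof. by apply: nsM; have [] := mS. Qed.

(** Each of the five terms shifts degrees by the degree of its coefficient: for
  p and q this is 4 b11 = 2 a1 - a2 and 4 b22 = 2 a2 - 4. *)
Lemma bd_homog d n (f : F d.+1) :
  homog (@bas_deg a) n f -> homog (@bas_deg a) n (bd a f).
Proof.
move=> hf s m; rewrite /bas_deg bd_coef.
have b11 : (4 * b 1 1 + a 2 = a 1 + a 1)%N.
  have := apery_bE mS apS h1 h2 h3 1 1; rewrite -[(1 + 1)%N]/2%N; lia.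
have b22 : (4 * b 2 2 + a 0 = a 2 + a 2)%N.
  have := apery_bE mS apS h1 h2 h3 2 2; rewrite -[a (2 + 2)]/(a 0); lia.
have hsign j w : S w -> sg_homog w ((-1) ^+ j * sg_mon k S w).
  rewrite -{2}[w]add0n => Sw.
  by apply: sg_homogM; [apply: sg_homog_sign | apply: sg_homog_mon].
have hbool (j : bool) w : S w -> sg_homog w (j%:R * sg_mon k S w).
  rewrite -{2}[w]add0n => Sw.
  by apply: sg_homogM; [apply: sg_homog_nat | apply: sg_homog_mon].
move: (val s) => c nz; apply/eqP; apply: contraNT nz => nm; apply/eqP.
have z phi w r t : (forall e, sg_homog w (phi e)) ->
    (t `<=` c -> mset_deg a ((c `\` t) `+` r) = (mset_deg a c + w)%N) ->
  (sgval (bd_term f phi r t c))`_m = 0.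
  move=> hphi hdeg; apply/eqP; apply: contraNT nm => nz.
  by apply/eqP; apply: bd_term_homog nz.
apply: coef_bd_sum0.
- apply: (z _ (a 2)) => [e|_]; first exact: sg_homog_mon.
  by rewrite !mset_degE !msetE2 !msetnE !mset0E !eqxx !ord3_eqE; lia.
- apply: (z _ (a 1)) => [e|_]; first exact: hsign.
  by rewrite !mset_degE !msetE2 !msetnE !mset0E !eqxx !ord3_eqE; lia.
- apply: (z _ (4 * b 1 1)%N) => [e|].
    by rewrite y_expE; apply: hbool; apply: S4M.
  rewrite msub1set in_mset !mset_degE !msetE2 !msetnE !eqxx !ord3_eqE.
  by move: (c i2) => [|c2] _ //; rewrite subn1 /= !mulnDl !mulSn; lia.
- apply: (z _ (a 0)) => [e|_]; first exact: hsign.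
  by rewrite !mset_degE !msetE2 !msetnE !mset0E !eqxx !ord3_eqE; lia.
apply: (z _ (4 * b 2 2)%N) => [e|].
  by rewrite y_expE; apply: hsign; apply: S4M.
rewrite msub1set in_mset !mset_degE !msetE2 !msetnE !eqxx !ord3_eqE.
by move: (c i0) => [|c0] _ //; rewrite subn1 /= !mulnDl !mulSn; lia.
Qed.

Lemma bd_residue0 d (f : F d.+1) (s : Bas d) :
  (0 < b 1 1)%N -> residue (bd a f s : R) = 0.
Proof.
move=> b11; have b22 := b22_gt0 mS apS h1 h2 h3.
have x0 i : residue (x i) = 0.
  by rewrite residue_mon ?(apery_coord_gt0 h1 h2 h3).
have y0 n : (0 < n)%N -> residue (y ^+ n) = 0.
  by case: n => // n _; rewrite exprS residueM x0 mul0r.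
have rM (r r' : R) : residue r' = 0 -> residue (r * r') = 0.
  by rewrite residueM => ->; rewrite mulr0.
rewrite bd_coef.
apply: coef_bd_sum0; apply: residue_bd_term => e.
- exact: x0.
- by apply: rM; apply: x0.
- by apply: rM; apply: y0.
- by apply: rM; apply: x0.
by apply: rM; apply: y0.
Qed.

(** When b11 = 0, the entry from the multiset {1, 1} to the multiset {2} is
  -p = -1. *)
Lemma bd_minimal_iff : minimal_resolution (@bd_lin k S a) <-> (0 < b 1 1)%N.
Proof.
split=> [min|b11 d u v c c0 e]; last first.
  case/eqP: c0; have := bd_residue0 (basis_elt k S u) v b11.
  by rewrite /residue [sgval _]e coefC.
rewrite lt0n; apply/eqP => b11.
pose u : Bas 2 := [` mset3_bas 2 0 (leq0n 1)]%fset.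
pose v : Bas 1 := [` mset3_bas 0 1 (leq0n 1)]%fset.
apply: (min 1%N u v (-1)); first by rewrite oppr_eq0 oner_eq0.
have -> : basis_elt k S u = of_seqs 2 (fun j => (j == 0%N)%:R) (fun=> 0).
  apply/ffunP=> s; rewrite !ffunE /seq_at -val_eqE [val u]/=.
  have := valP s; rewrite in_bas3; move: (val s) => c /andP[/eqP sc c0].
  rewrite -mulrb -mulrnA mulnb andbC; congr (nat_of_bool _)%:R.
  apply/eqP/andP=> [->|[/eqP z0 /eqP z2]]; first by rewrite !mset3E.
  by apply: eq_mset3; rewrite mset3E; lia.
rewrite [bd_lin _ _ _ _ _]bd_of_seqs ffunE /seq_at /= !mset3E.
rewrite /cone0 /strand_map /=.
rewrite b11 !mulr0 addr0 expr0 mulr1 addr0 sub0r.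
rewrite polyCN; exact: (rmorphN1 (val : R -> {poly k})).
Qed.

Hypothesis hsum : (a3 = a1 + a2)%N.

Lemma bd_resolution : graded_free_resolution (@bas_deg a) (@bd_lin k S a)
    (M := resfield k S) (@res_homog k S).
Proof.
have exact0 h : residue (h 0%N : R) = 0 <->
    exists g g', h 0%N = cone0 y (x 1) (x 2) (y ^+ b 1 1) ((-1) ^+ 0) g g' 0.
  rewrite (residue0P mS apS h1 h2 h3 hsum) /cone0 /strand_map /= expr0; split.
    move=> [u [v [w e]]].
    exists (fun j => if j == 0%N then u else v), (fun=> w).
    by rewrite e !mul1r subr0 [_ * u + _]addrC.
  move=> [g [g' ->]]; exists (g 0%N), (g 1%N), (g' 0%N).
  by rewrite !mul1r subr0 [x 2 * _ + _]addrC.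
split=> [d n f||d f]; first exact: bd_homog.
  exists (@augmentation k S); split=> [n f hf|v|f].
  - move=> f0; have := hf _ _ f0; rewrite /bas_deg mset_degE.
    by rewrite [val _]/= !mset3E !mul0n.
  - exists (of_seqs 0 (fun=> SgAlg (polyC_supp S v)) (fun=> 0)).
    by apply: etrans (augmentation_of_seqs _ _) _; rewrite /residue /= coefC.
  have [h [h' ->]] := of_seqs_onto f.
  (* Only the entry with index 0 counts, and the boundaries there are the
     elements x1 u + x2 v + y w, which form the maximal ideal. *)
  change (augmentation (of_seqs 0 h h') = 0 <->
    exists g, of_seqs 0 h h' = bd a g).
  rewrite augmentation_of_seqs exact0; split.
    move=> [g [g' e]]; exists (of_seqs 1 g g').
    by rewrite bd_of_seqs; apply/of_seqs_eq; split=> // -[].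
  move=> [g]; have [l [l' ->]] := of_seqs_onto g.
  rewrite bd_of_seqs => /of_seqs_eq[/(_ 0%N isT) e _].
  by exists l, l'.
have sgn : (-1) ^+ d * (-1) ^+ d = 1 :> R by rewrite -expr2 sqrr_sign.
have [h [h' ->]] := of_seqs_onto f.
have zero n : 0 = of_seqs n (fun=> 0) (fun=> 0) :> F n.
  by apply/ffunP=> s; rewrite !ffunE /seq_at if_same.
split=> [|[g]].
  rewrite [X in X = 0 -> _]bd_of_seqs zero => /of_seqs_eq[cyc _].
  have [g [g' [e e']]] := cone_exact (x1_sqr k mS apS h1 h2 h3)
    (x2_sqr k mS apS h1 h2 h3) (@y_reg k _ _ _ _ mS apS)
    (@x2_ann k _ _ _ _ mS apS hsum) (@x1_ann k _ _ _ _ mS apS h1 h2 h3 hsum)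
    sgn cyc.
  exists (of_seqs d.+2 g g'); rewrite [RHS]bd_of_seqs exprS mulN1r.
  exact/of_seqs_eq.
have [l [l' ->]] := of_seqs_onto g => ->.
change (bd a (bd a (of_seqs d.+2 l l')) = 0).
rewrite !bd_of_seqs zero exprS mulN1r; set e := (-1) ^+ d in sgn *.
have esgn : - e * - e = 1 by rewrite mulrNN.
apply/of_seqs_eq; split=> j _; rewrite -{1}[e]opprK.
  by apply: cone0_sqr; [apply: x1_sqr | apply: x2_sqr | ].
by apply: cone1_sqr; [apply: x1_sqr | apply: x2_sqr | ].
Qed.

End Main.

Theorem theorem4p2 (k : fieldType) (S : numSemigroup) (a1 a2 a3 : nat)
    (hmult : is_multiplicity S 4)
    (hapery : apery S 4 =i [:: 0%N; a1; a2; a3])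
    (ha1 : (a1 = 1 %[mod 4])%N)
    (ha2 : (a2 = 2 %[mod 4])%N)
    (ha3 : (a3 = 3 %[mod 4])%N)
    (hsum : (a3 = a1 + a2)%N) :
  let a := apery_coord a1 a2 a3 in
  graded_free_resolution (@bas_deg a) (@bd_lin k S a)
    (M := resfield k S) (@res_homog k S)
  /\ (minimal_resolution (@bd_lin k S a) <-> (0 < apery_b a 1 1)%N).
Proof. by move=> a; split; [apply: bd_resolution | apply: bd_minimal_iff]. Qed.
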